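(* Let $G$ be a connected finite simple graph with vertex set $\{0,1,\dots,n\}$ consisting of two subgraphs $G_1=(V_1,E_1)$ and $G_2=(V_2,E_2)$ sharing a single edge $e=\{k_1,k_2\}$; that is, $V(G)=V_1\cup V_2$, $E(G)=E_1\cup E_2$, $V_1\cap V_2=\{k_1,k_2\}$ and $E_1\cap E_2=\{e\}$. Let $G_1'$ and $G_2'$ be the contractions of $G_1$ and $G_2$ along $e$. Then the cells of the edge contraction subdivision $\mathcal{D}_{k_1,k_2}$ of the adjacency polytope $\nabla_G$ are in one-to-one correspondence with the pairs in $\mathcal{F}(\nabla_{G_1'})\times\mathcal{F}(\nabla_{G_2'})$.
   Context: For a connected finite simple graph $G$ with vertex set $\{0,1,\dots,n\}$ and edge set $E(G)$, let $\mathbf{e}_1,\dots,\mathbf{e}_n$ be the standard basis of $\mathbb{R}^n$ and $\mathbf{e}_0=\mathbf{0}$. Put $A_G=\{\mathbf{e}_i-\mathbf{e}_j : \{i,j\}\in E(G)\}$ (both orientations of every edge are included). The adjacency polytope is $\nabla_G=\operatorname{conv}(A_G)\subset\mathbb{R}^n$. For a connected graph with another vertex set, relabel its $m+1$ vertices by $0,1,\dots,m$ (different relabelings give linearly isomorphic polytopes). $\mathcal{F}(\nabla_G)$ denotes the set of facets of $\nabla_G$ (proper faces of maximal dimension); if $G$ has a single vertex then $\nabla_G=\{\mathbf{0}\}$ and by convention its only facet is $\varnothing$. Contraction: for an edge $e=\{a,b\}$ of a simple graph $H$, the contraction of $H$ along $e$ is the simple graph obtained by merging $a$ and $b$ into one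 vertex (removing the resulting loop and merging parallel edges). Edge contraction subdivision: for an edge $\{k_1,k_2\}\in E(G)$, let $\omega:A_G\to\mathbb{Z}$ be given by $\omega(\mathbf{e}_i-\mathbf{e}_j)=0$ if $\{i,j\}=\{k_1,k_2\}$ and $\omega(\mathbf{e}_i-\mathbf{e}_j)=1$ otherwise. $\mathcal{D}_{k_1,k_2}$ is the regular subdivision of $\nabla_G$ (as a subdivision of the point configuration $A_G$) induced by $\omega$: its cells are the subsets $C\subseteq A_G$ with $\dim\operatorname{conv}(C)=n$ for which there exist $\boldsymbol\alpha\in\mathbb{R}^n$ and $h\in\mathbb{R}$ with $\langle\mathbf{x},\boldsymbol\alpha\rangle+\omega(\mathbf{x})=h$ for all $\mathbf{x}\in C$ and $\langle\mathbf{x},\boldsymbol\alpha\rangle+\omega(\mathbf{x})>h$ for all $\mathbf{x}\in A_G\setminus C$. *)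

(* Defs.v *)
From mathcomp Require Import all_boot all_order all_algebra.
From mathcomp Require Import boolp classical_sets functions reals.

Set Implicit Arguments.
Unset Strict Implicit.
Unset Printing Implicit Defensive.

Import Order.TTheory GRing.Theory Num.Theory.
Local Open Scope ring_scope.

(* Finite simple graphs whose vertices form a subset of an ambient finite type,
   so that subgraphs and contractions of a graph live over the same type. *)
Record sgraph (T : finType) := SGraph {
  vertices : {set T};
  edges : {set {set T}};
  edgesP : forall e, e \in edges -> (e \subset vertices) && (#|e| == 2)%N
}.

Definition adjacent (T : finType) (G : sgraph T) : rel T :=
  fun x y => [set x; y]%SET \in edges G.

Definition connected_graph (T : finType) (G : sgraph T) : Prop :=
  vertices G != finset.set0 /\
  {in vertices G &, forall x y, connect (adjacent G) x y}.

Section Contraction.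
Variables (T : finType) (G : sgraph T) (a b : T).

Definition merge_vertex (x : T) : T := if x == b then a else x.

(* An edge {x, y} becomes {merge_vertex x, merge_vertex y}; the loops are the
   images of cardinality 1, and parallel edges coincide as sets. *)
Definition contraction_edges : {set {set T}} :=
  [set d in [set merge_vertex @: e | e : {set T} in edges G] | (#|d| == 2)%N]%SET.

Lemma contraction_edgesP (d : {set T}) : d \in contraction_edges ->
  (d \subset merge_vertex @: vertices G) && (#|d| == 2)%N.
Proof.
rewrite inE => /andP[/imsetP[e eG ->] ->]; rewrite andbT.
by have /andP[eV _] := edgesP eG; apply: imsetS.
Qed.

Definition contraction : sgraph T := SGraph contraction_edgesP.

End Contraction.

(* H is obtained from G by relabelling the m + 1 vertices of G by 0, ..., m. *)
Definition relabelling (T : finType) (m : nat) (G : sgraph T)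
    (H : sgraph 'I_m.+1) : Prop :=
  exists l : T -> 'I_m.+1,
    [/\ {in vertices G &, injective l},
        l @: vertices G = [set: 'I_m.+1]%SET,
        vertices H = [set: 'I_m.+1]%SET
      & edges H = [set l @: e | e : {set T} in edges G]%SET].

Section Polytopes.
Variables (R : realType) (n : nat).
Implicit Types (x y alpha : 'rV[R]_n) (h : R) (S P F A C : set 'rV[R]_n).

Definition dot x alpha : R := \sum_(i < n) x 0 i * alpha 0 i.

Definition convex_hull S : set 'rV[R]_n :=
  [set x | exists (k : nat) (p : 'I_k -> 'rV[R]_n) (c : 'I_k -> R),
     [/\ forall i, S (p i), forall i, 0 <= c i, \sum_i c i = 1
       & x = \sum_i c i *: p i]]%classic.

Definition affinely_independent (k : nat) (p : 'I_k -> 'rV[R]_n) : Prop :=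
  forall c : 'I_k -> R,
    \sum_i c i = 0 -> \sum_i c i *: p i = 0 -> forall i, c i = 0.

(* The maximal number of affinely independent points of S, minus one; the
   dimension of the empty set is -1.  The bound on k is harmless: at most
   n + 1 points of R^n are affinely independent. *)
Definition affine_dim S : int :=
  (\max_(k < n.+2 | `[< exists p : 'I_k -> 'rV[R]_n,
                         (forall i, S (p i)) /\ affinely_independent p >]) k)%N%:Z
  - 1.

(* Taking alpha = 0 yields P itself and the empty face. *)
Definition face P F : Prop :=
  exists alpha h,
    (forall x, P x -> h <= dot x alpha) /\
    F = [set x | P x /\ dot x alpha = h]%classic.

Definition proper_face P F : Prop := face P F /\ F <> P.

(* As the empty set is a face, the only facet of a point is the empty set. *)
Definition facets P : set (set 'rV[R]_n) :=
  [set F | proper_face P F /\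
     forall F', proper_face P F' -> affine_dim F' <= affine_dim F]%classic.

Definition regular_subdivision A (w : 'rV[R]_n -> int) : set (set 'rV[R]_n) :=
  [set C | [/\ (C `<=` A)%classic, affine_dim (convex_hull C) = n%:Z
    & exists alpha h,
        (forall x, C x -> dot x alpha + (w x)%:~R = h) /\
        (forall x, (A `\` C)%classic x -> h < dot x alpha + (w x)%:~R)]]%classic.

(* e_0 = 0 and e_1, ..., e_n is the standard basis. *)
Definition vertex_point (i : 'I_n.+1) : 'rV[R]_n :=
  if unlift ord0 i is Some j then delta_mx 0 j else 0.

Definition adjacency_config (G : sgraph 'I_n.+1) : set 'rV[R]_n :=
  [set x | exists i j, adjacent G i j /\ x = vertex_point i - vertex_point j]
  %classic.

(* The graph with a single vertex has no edge, but its polytope is {0}. *)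
Definition adjacency_polytope (G : sgraph 'I_n.+1) : set 'rV[R]_n :=
  if (n == 0)%N then [set 0]%classic else convex_hull (adjacency_config G).

(* A point e_i - e_j with i <> j determines (i, j), so this depends only on
   whether {i, j} = {k1, k2}. *)
Definition contraction_weight (k1 k2 : 'I_n.+1) (x : 'rV[R]_n) : int :=
  if (x == vertex_point k1 - vertex_point k2)
     || (x == vertex_point k2 - vertex_point k1) then 0 else 1.

Definition edge_contraction_subdivision (G : sgraph 'I_n.+1) (k1 k2 : 'I_n.+1) :
    set (set 'rV[R]_n) :=
  regular_subdivision (adjacency_config G) (contraction_weight k1 k2).

End Polytopes.

(* Main.v *)
Require Import Defs.
From mathcomp Require Import all_boot all_order all_algebra.
From mathcomp Require Import boolp classical_sets functions reals.
From mathcomp Require Import ring lra.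

(** A linear functional alpha on the ambient space is the same as a potential
phi on the vertices, up to an additive constant: its value on the arc
e_i - e_j is phi i - phi j.  Facets and cells both translate into potentials.

Facets.  As the polytope of a connected graph H is symmetric with 0 in its
interior, a facet is cut out by a functional normalised to be >= -1 on all
arcs and equal to -1 on the facet.  The corresponding potential changes by at
most 1 along every edge, and its tight edges, where it changes by exactly 1,
must connect H, for otherwise the facet would not span a hyperplane.  The
connectivity of the tight edges is expressed by rigidity: a potential that is
constant along them is constant.  Conversely each such potential gives a
facet, and the facet determines it up to a constant ([facetsP],
[facet_of_inj]).

Cells.  A full-dimensional cell supported at (alpha, h) has h <= 0, because
both orientations of e = {k1, k2} have weight 0.  The value h < 0 is
impossible: the potential, read modulo 1 - h, would separate k1 from k2 and
allow alpha to be corrected into a functional constant on the cell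
([cell_height_ge0]).  So h = 0, whence phi k1 = phi k2, and the supporting
inequalities on the remaining arcs say again that phi changes by at most 1
along each edge; fullness says that e and the tight edges together connect G
([edge_contraction_subdivisionP]).

Hence the cells are the facet potentials of the contraction G / e, which is
G1 / e and G2 / e glued at one vertex.  A potential on such a union is a pair
of potentials agreeing at the common vertex, which can always be arranged by
adding a constant; the change along edges is tested in each part separately,
and the tight edges connect the union if and only if they connect both parts
([glue_cell_potential], [split_cell_potential], [exists_glued_potential]).
Contractions and relabellings are only seen through the composite vertex map
([edge_quotient]).

Finally a facet is a proper face of maximal dimension, so identifying its
dimension as m - 1 requires one facet potential to exist; the distance to
{k1, k2} in G provides it ([exists_cell_potential]). *)

Set Implicit Arguments.
Unset Strict Implicit.
Unset Printing Implicit Defensive.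

Import Order.TTheory GRing.Theory Num.Theory.
Local Open Scope ring_scope.

(** * Affine dimension and affine functionals *)

Section AffineDimension.
Variables (R : realType) (n : nat).
Implicit Types (x y alpha beta : 'rV[R]_n) (h : R) (S P F : set 'rV[R]_n).

Lemma dotDl x y alpha : dot (x + y) alpha = dot x alpha + dot y alpha.
Proof. by rewrite -big_split; apply: eq_bigr => i _; rewrite mxE mulrDl. Qed.

Lemma dotZl c x alpha : dot (c *: x) alpha = c * dot x alpha.
Proof. by rewrite mulr_sumr; apply: eq_bigr => i _; rewrite mxE mulrA. Qed.

Lemma dotC x y : dot x y = dot y x.
Proof. by apply: eq_bigr => i _; rewrite mulrC. Qed.

Lemma dotNl x alpha : dot (- x) alpha = - dot x alpha.
Proof. by rewrite -scaleN1r dotZl mulN1r. Qed.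

Lemma dotBl x y alpha : dot (x - y) alpha = dot x alpha - dot y alpha.
Proof. by rewrite dotDl dotNl. Qed.

Lemma dotZr c x alpha : dot x (c *: alpha) = c * dot x alpha.
Proof. by rewrite dotC dotZl dotC. Qed.

Lemma dotNr x alpha : dot x (- alpha) = - dot x alpha.
Proof. by rewrite dotC dotNl dotC. Qed.

Lemma dot0l alpha : dot 0 alpha = 0.
Proof. by rewrite -(scale0r 0) dotZl mul0r. Qed.

Lemma dot0r x : dot x 0 = 0.
Proof. by rewrite dotC dot0l. Qed.

Lemma dot_suml k (c : 'I_k -> R) (p : 'I_k -> 'rV[R]_n) alpha :
  dot (\sum_i c i *: p i) alpha = \sum_i c i * dot (p i) alpha.
Proof.
apply: (big_ind2 (fun x s => dot x alpha = s)); first exact: dot0l.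
  by move=> x a y b <- <-; rewrite dotDl.
by move=> i _; rewrite dotZl.
Qed.

Lemma affine_dim_le S : affine_dim S <= n%:Z.
Proof.
rewrite /affine_dim lerBlDr -PoszD lez_nat addn1.
by apply/bigmax_leqP => i _; rewrite -ltnS.
Qed.

Lemma affine_dim_ge S k (p : 'I_k -> 'rV[R]_n) :
  (k < n.+2)%N -> (forall i, S (p i)) -> affinely_independent p ->
  k%:Z - 1 <= affine_dim S.
Proof.
move=> kn Sp ip; rewrite lerD2r lez_nat.
apply: (@leq_bigmax_cond _ _ (fun k : 'I_n.+2 => k : nat) (Ordinal kn)).
by apply/asboolP; exists p.
Qed.

(** The maximum in the definition of the dimension is attained, the empty family
being always available. *)
Lemma affine_dim_witness S : exists k (p : 'I_k -> 'rV[R]_n),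
  [/\ (k <= n.+1)%N, affine_dim S = k%:Z - 1, forall i, S (p i)
    & affinely_independent p].
Proof.
pose Q (k : 'I_n.+2) := `[< exists p : 'I_k -> 'rV[R]_n,
  (forall i, S (p i)) /\ affinely_independent p >].
have Q0 : (0 < #|[pred k | Q k]|)%N.
  have Q00 : Q ord0 by apply/asboolP;
    exists (fun=> 0); split=> [[m //]|c _ _ [m //]].
  by apply/card_gt0P; exists ord0; exact: Q00.
have [k Qk dk] := eq_bigmax_cond (fun k : 'I_n.+2 => k : nat) Q0.
have /asboolP[p [Sp ip]] : Q k := Qk.
have dS : affine_dim S = k%:Z - 1 by rewrite /affine_dim -dk.
have kn : (k <= n.+1)%N by rewrite -ltnS.
by exists k, p; split.
Qed.

Definition add_point k (p : 'I_k -> 'rV[R]_n) y (i : 'I_k.+1) : 'rV[R]_n :=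
  if unlift ord0 i is Some j then p j else y.

Lemma add_point0 k (p : 'I_k -> 'rV[R]_n) y : add_point p y ord0 = y.
Proof. by rewrite /add_point unlift_none. Qed.

Lemma add_point_lift k (p : 'I_k -> 'rV[R]_n) y j :
  add_point p y (lift ord0 j) = p j.
Proof. by rewrite /add_point liftK. Qed.

(** In a vanishing combination the coefficient of [y] must vanish, as one sees by
applying the functional [alpha - h], which kills the family but not [y]. *)
Lemma affinely_independent_add k (p : 'I_k -> 'rV[R]_n) y alpha h :
  (forall i, dot (p i) alpha = h) -> dot y alpha <> h ->
  affinely_independent p -> affinely_independent (add_point p y).
Proof.
move=> ph yh ip c c0 cp0.
have E : \sum_i c i *: add_point p y i
       = c ord0 *: y + \sum_i c (lift ord0 i) *: p i.
  rewrite big_ord_recl add_point0; congr (_ + _).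
  by apply: eq_bigr => i _; rewrite add_point_lift.
rewrite E in cp0; rewrite big_ord_recl in c0.
have c00 : c ord0 = 0.
  have := congr1 (fun x => dot x alpha) cp0; rewrite dot0l dotDl dotZl dot_suml.
  rewrite (eq_bigr (fun i => c (lift ord0 i) * h)) => [|i _]; last by rewrite ph.
  rewrite -mulr_suml => e; apply/eqP.
  have cs : \sum_i c (lift ord0 i) = - c ord0.
    by apply/eqP; rewrite -addr_eq0 addrC c0.
  have : c ord0 * (dot y alpha - h) == 0 by rewrite -e cs; apply/eqP; ring.
  by rewrite mulf_eq0 subr_eq0 => /orP[/eqP//|/eqP].
rewrite c00 add0r in c0; rewrite c00 scale0r add0r in cp0.
move=> i; case: (unliftP ord0 i) => [j ->|-> //].
exact: (ip (fun i => c (lift ord0 i))).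
Qed.

(** The affine functionals form a space of dimension [n + 1], so [k <= n] linear
conditions leave a nonzero one. *)
Lemma exists_annihilator k (p : 'I_k -> 'rV[R]_n) : (k <= n)%N ->
  exists alpha h, (forall i, dot (p i) alpha = h) /\ ~ (alpha = 0 /\ h = 0).
Proof.
move=> kn.
pose M : 'M[R]_(n + 1, k) := col_mx (\matrix_(j, i) p i 0 j) (const_mx (-1)).
have : kermx M != 0.
  rewrite -mxrank_eq0 mxrank_ker subn_eq0 -ltnNge.
  by apply: leq_ltn_trans (rank_leq_col M) _; rewrite addn1 ltnS.
case/rowV0Pn => v /sub_kermxP vM v0.
exists (lsubmx v), (rsubmx v 0 0); split=> [i|[l0 r0]].
  move: vM; rewrite -{1}[v]hsubmxK mul_row_col => /matrixP/(_ 0 i).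
  rewrite !mxE big_ord1 !mxE mulrN1 => /eqP; rewrite subr_eq0 => /eqP <-.
  by apply: eq_bigr => j _; rewrite !mxE mulrC.
case/eqP: v0; rewrite -[v]hsubmxK l0; have -> : rsubmx v = 0.
  by apply/rowP => i; rewrite (ord1 i) r0 mxE.
by rewrite row_mx0.
Qed.

(** Phrased dually, because every argument about facets and cells produces
functionals rather than families of points. *)
Definition affinely_spans S : Prop :=
  forall alpha h, (forall x, S x -> dot x alpha = h) -> alpha = 0 /\ h = 0.

(** The common step of the two dimension criteria below: a point of [S] off a
hyperplane containing an independent family enlarges it, so that no family of
size [k] is maximal. *)
Lemma affine_dim_neq S k : (k <= n)%N ->
  (forall p : 'I_k -> 'rV[R]_n, (forall i, S (p i)) -> exists alpha h x,
     [/\ forall i, dot (p i) alpha = h, S x & dot x alpha <> h]) ->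
  affine_dim S != k%:Z - 1.
Proof.
move=> kn ext; have [k' [p [_ dS Sp ip]]] := affine_dim_witness S.
apply/eqP => dk; have kk : k' = k.
  by move: dk; rewrite dS => /addIr [].
subst k'; have [alpha [h [x [ph Sx xh]]]] := ext p Sp.
have : k.+1%:Z - 1 <= affine_dim S.
  apply: (affine_dim_ge (p := add_point p x)) => //.
    by move=> i; rewrite /add_point; case: unlift.
  exact: affinely_independent_add ph xh ip.
by rewrite dS lerD2r lez_nat ltnn.
Qed.

Lemma affinely_independent_card k (p : 'I_k -> 'rV[R]_n) :
  affinely_independent p -> (k <= n.+1)%N.
Proof.
move=> ip.
pose M : 'M[R]_(k, n + 1) := row_mx (\matrix_(i, j) p i 0 j) (const_mx 1).
suff : row_free M by move=> /eqP <-; rewrite -(addn1 n) rank_leq_col.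
apply: inj_row_free => v; rewrite mul_mx_row -row_mx0.
case/eq_row_mx => /rowP vp /rowP v1; apply/rowP => i; rewrite [RHS]mxE.
apply: (ip (fun i => v 0 i)).
  have := v1 0; rewrite !mxE => e; rewrite -[RHS]e.
  by apply: eq_bigr => j _; rewrite mxE mulr1.
apply/rowP => j; rewrite -vp summxE mxE.
by apply: eq_bigr => l _; rewrite !mxE.
Qed.

Lemma dot_const alpha h : (forall y, dot y alpha = h) -> alpha = 0 /\ h = 0.
Proof.
move=> ah; have h0 : h = 0 by rewrite -(ah 0) dot0l.
split=> //; apply/rowP => i; rewrite mxE.
have := ah (delta_mx 0 i); rewrite h0 /dot (bigD1 i) //= big1 => [|j ji].
  by rewrite mxE !eqxx mul1r addr0.
by rewrite mxE (negbTE ji) andbF mul0r.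
Qed.

(** A nonzero functional vanishing on [n + 1] independent points would leave room
for one more point; conversely a smaller independent family has a nonzero
annihilator, which cannot vanish on all of [S] if [S] spans. *)
Lemma affine_dim_fullP S : affine_dim S = n%:Z <-> affinely_spans S.
Proof.
split=> [dS alpha h Sh|spS].
  have [k [p [_ dS' Sp ip]]] := affine_dim_witness S.
  have kn : k = n.+1.
    by apply/eqP; rewrite -eqz_nat -[n.+1]addn1 PoszD -dS dS' subrK.
  apply: dot_const => y; apply: contrapT => yh.
  have /affinely_independent_card := affinely_independent_add
    (fun i => Sh _ (Sp i)) yh ip.
  by rewrite kn ltnn.
have [k [p [kn dS Sp ip]]] := affine_dim_witness S.
case: (leqP k n) => [kn'|nk]; last first.
  have -> : n%:Z = n.+1%:Z - 1 by rewrite -addn1 PoszD addrK.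
  by rewrite dS; congr (_%:Z - 1); apply/eqP; rewrite eqn_leq kn.
suff : affine_dim S != k%:Z - 1 by rewrite dS eqxx.
apply: affine_dim_neq => // q Sq.
have [alpha [h [qh ah]]] := exists_annihilator q kn'.
have : exists x, ~ (S x -> dot x alpha = h).
  by apply/existsNP => /spS.
by case=> x /not_implyP[Sx xh]; exists alpha, h, x.
Qed.

Lemma affine_dim_hyperplane S alpha h :
  (forall x, S x -> dot x alpha = h) -> ~ (alpha = 0 /\ h = 0) ->
  affine_dim S <= n%:Z - 1.
Proof.
move=> Sh ah; rewrite -ltzD1 subrK lt_neqAle affine_dim_le andbT.
by apply/eqP => /affine_dim_fullP/(_ _ _ Sh).
Qed.

(** Adding a point off a hyperplane raises the dimension by exactly one.  With
[y = 0] this lets the dimension of a facet be computed from the functionals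
vanishing on it. *)
Lemma affine_dim_add_point S y alpha h :
  (forall x, S x -> dot x alpha = h) -> dot y alpha <> h ->
  affine_dim S = n%:Z - 1 <-> affinely_spans (S `|` [set y])%classic.
Proof.
move=> Sh yh; have [k [p [kn dS Sp ip]]] := affine_dim_witness S.
have Sle : affine_dim S <= n%:Z - 1.
  apply: (affine_dim_hyperplane Sh) => -[a0 h0].
  by apply: yh; rewrite a0 h0 dot0r.
split=> [dn|spS].
  have {}kn : k = n by move: dn; rewrite dS => /addIr [].
  subst k; apply/affine_dim_fullP/eqP; rewrite eq_le affine_dim_le /=.
  have -> : n%:Z = n.+1%:Z - 1 by rewrite -addn1 PoszD addrK.
  apply: (affine_dim_ge (p := add_point p y)) => //.
    by move=> i; rewrite /add_point; case: unlift => [j|]; [left|right].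
  by apply: affinely_independent_add yh ip => i; exact: Sh.
case: (ltnP k n) => [kn'|nk]; last first.
  by apply/eqP; rewrite eq_le Sle dS lerD2r lez_nat.
suff : affine_dim S != k%:Z - 1 by rewrite dS eqxx.
apply: affine_dim_neq => [|q Sq]; first exact: ltnW.
have [beta [c [qc bc]]] := exists_annihilator (add_point q y) kn'.
have : exists x, ~ ((S `|` [set y])%classic x -> dot x beta = c).
  by apply/existsNP => /spS.
case=> x /not_implyP[[Sx|/= ->] xc]; last first.
  by case: xc; have := qc ord0; rewrite add_point0.
exists beta, c, x; split=> // i.
by have := qc (lift ord0 i); rewrite add_point_lift.
Qed.

End AffineDimension.

(** * Potentials and functionals *)

Section Potentials.
Variables (R : realType) (n : nat).
Implicit Types (phi psi : 'I_n.+1 -> R) (alpha : 'rV[R]_n).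

Definition row_of_potential phi : 'rV[R]_n :=
  \row_j (phi (lift ord0 j) - phi ord0).

Definition potential_of_row alpha (i : 'I_n.+1) : R :=
  dot (vertex_point R i) alpha.

(** The constant [phi ord0] cancels, which is why potentials matter only up to
constants although the vertex 0 is placed at the origin. *)
Lemma dot_arc phi i j :
  dot (vertex_point R i - vertex_point R j) (row_of_potential phi)
  = phi i - phi j.
Proof.
have vE k : dot (vertex_point R k) (row_of_potential phi) = phi k - phi ord0.
  rewrite /vertex_point; case: (unliftP ord0 k) => [l ->|->].
    rewrite /dot (bigD1 l) //= big1 => [|a /negbTE al].
      by rewrite !mxE !eqxx mul1r addr0.
    by rewrite !mxE al andbF mul0r.
  by rewrite dot0l subrr.
by rewrite dotBl !vE; ring.
Qed.

Lemma potential_of_rowB alpha i j :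
  dot (vertex_point R i - vertex_point R j) alpha
  = potential_of_row alpha i - potential_of_row alpha j.
Proof. exact: dotBl. Qed.

Lemma potential_of_rowK alpha : row_of_potential (potential_of_row alpha) = alpha.
Proof.
apply/rowP => j; rewrite mxE /potential_of_row /vertex_point liftK unlift_none.
rewrite dot0l subr0 /dot (bigD1 j) //= big1 => [|a /negbTE al].
  by rewrite !mxE !eqxx mul1r addr0.
by rewrite !mxE al andbF mul0r.
Qed.

Lemma row_of_potential_eq phi psi :
  (forall i j, phi i - phi j = psi i - psi j) ->
  row_of_potential phi = row_of_potential psi.
Proof. by move=> e; apply/rowP => j; rewrite !mxE. Qed.

Lemma row_of_potential0 phi :
  (forall i j, phi i = phi j) -> row_of_potential phi = 0.
Proof. by move=> e; apply/rowP => j; rewrite !mxE (e _ ord0) subrr. Qed.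

(** Indicator functions of vertices are potentials separating the arcs. *)
Lemma arc_inj (i j k l : 'I_n.+1) : i != j ->
  vertex_point R i - vertex_point R j = vertex_point R k - vertex_point R l ->
  i = k /\ j = l.
Proof.
move=> ij E.
have D phi : phi i - phi j = phi k - phi l by rewrite -!dot_arc E.
have := D (fun v => (v == i)%:R); have := D (fun v => (v == j)%:R).
rewrite !eqxx (negbTE ij) [j == i]eq_sym (negbTE ij) => e1 e2.
suff : (k == i) && (l == j) by case/andP => /eqP -> /eqP ->.
apply: contraT => N; suff : (0 : R) < 0 by rewrite ltxx.
by move: N e1 e2; clear E; do 4![case: (_ == _) => //=] => _ e1 e2; lra.
Qed.

End Potentials.

Section TightPotentials.
Variables (R : realType) (T : finType).
Implicit Types (e : rel T) (phi psi : T -> R).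

Definition lipschitz e phi : Prop := forall x y, e x y -> phi x - phi y <= 1.

(** On a symmetric relation it is enough to consider the orientation in which
[phi] decreases. *)
Definition tight_constant e phi psi : Prop :=
  forall x y, e x y -> phi x - phi y = 1 -> psi x = psi y.

Definition constant_potential psi : Prop := forall x y, psi x = psi y.

(** The second clause says that the edges along which [phi] changes by 1 connect
all of [T]; in terms of functionals, that they span the whole space. *)
Definition facet_potential e phi : Prop :=
  lipschitz e phi /\
  forall psi, tight_constant e phi psi -> constant_potential psi.

(** A facet potential of the graph with [k1] and [k2] identified. *)
Definition cell_potential e k1 k2 phi : Prop :=
  [/\ phi k1 = phi k2, lipschitz e phi
    & forall psi, psi k1 = psi k2 -> tight_constant e phi psi ->
        constant_potential psi].

End TightPotentials.

Section AdjacencySymmetry.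
Variables (T : finType) (G : sgraph T).

Lemma adjacentC x y : adjacent G x y = adjacent G y x.
Proof. by rewrite /adjacent finset.setUC. Qed.

Lemma adjacent_neq x y : adjacent G x y -> x != y.
Proof.
move=> /edgesP/andP[_ /eqP c]; apply/eqP => xy.
by move: c; rewrite xy finset.setUid cards1.
Qed.

End AdjacencySymmetry.

(** * Facets of the adjacency polytope *)

Section Facets.
Variables (R : realType) (m : nat) (H : sgraph 'I_m.+1).
Local Notation P := (@adjacency_polytope R m H).
Local Notation vp := (vertex_point R).
Local Notation e := (adjacent H).
Implicit Types (phi psi : 'I_m.+1 -> R) (alpha : 'rV[R]_m).

Definition facet_of phi : set 'rV[R]_m :=
  [set x | P x /\ dot x (row_of_potential phi) = -1]%classic.

Lemma polytope_arc i j : e i j -> P (vp i - vp j).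
Proof.
move=> eij; rewrite /adjacency_polytope; case: eqP => [m0|_]; last first.
  exists 1, (fun=> vp i - vp j), (fun=> 1); split=> //.
  - by move=> _; exists i, j.
  - by rewrite big_ord1.
  - by rewrite big_ord1 scale1r.
by subst m; move: (adjacent_neq eij); rewrite (ord1 i) (ord1 j) eqxx.
Qed.

(** If there is an edge, 0 is the midpoint of its two orientations.  Without any
edge every potential satisfies [tight_constant], so that rigidity leaves a
single vertex. *)
Lemma polytope0 phi : facet_potential e phi -> P 0.
Proof.
rewrite /adjacency_polytope => -[_ rig]; case: eqP => [//|m0].
have [[i [j eij]]|ne] := pselect (exists i j, e i j); last first.
  have /eqP : (ord0 == ord0 :> 'I_m.+1)%:R = (ord_max == ord0 :> 'I_m.+1)%:R :> R.
    apply: (rig (fun v => (v == ord0)%:R)) => i j eij.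
    by case: ne; exists i, j.
  have -> : (ord_max == ord0 :> 'I_m.+1) = false by apply/eqP => /(congr1 val).
  by rewrite eqxx oner_eq0.
exists 2, (fun k => if k == ord0 then vp i - vp j else vp j - vp i), (fun=> 2^-1).
split=> [k|_||].
- by case: ifP => _; [exists i, j|exists j, i; rewrite adjacentC].
- by rewrite invr_ge0.
- by rewrite big_ord_recl big_ord1; lra.
by rewrite big_ord_recl big_ord1 /= -(opprB (vp i)) scalerN subrr.
Qed.

Lemma polytope_dot_ge alpha h : h <= 0 ->
  (forall i j, e i j -> h <= dot (vp i - vp j) alpha) ->
  forall x, P x -> h <= dot x alpha.
Proof.
rewrite /adjacency_polytope => h0 arc x; case: eqP => [_ ->|_].
  by rewrite dot0l.
case=> k [p [c [pA c0 c1 ->]]]; rewrite dot_suml -[h]mul1r -c1 mulr_suml.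
apply: ler_sum => i _; apply: ler_wpM2l => //.
by have [a [b [eab ->]]] := pA i; exact: arc.
Qed.

(** A point of the facet is a convex combination of arcs on each of which the
functional of [phi] is at least -1; as the average is -1, only tight arcs
contribute. *)
Lemma facet_of_dot0 phi psi : lipschitz e phi -> tight_constant e phi psi ->
  forall x, facet_of phi x -> dot x (row_of_potential psi) = 0.
Proof.
move=> lip tc x []; rewrite /adjacency_polytope; case: eqP => [_ ->|_].
  by rewrite !dot0l.
case=> k [p [c [pA c0 c1 ->]]]; rewrite !dot_suml => s.
have ge i : 0 <= dot (p i) (row_of_potential phi) + 1.
  have [a [b [eab ->]]] := pA i; rewrite dot_arc.
  by have := lip b a; rewrite adjacentC => /(_ eab); lra.
have : \sum_i c i * (dot (p i) (row_of_potential phi) + 1) = 0.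
  under eq_bigr do rewrite mulrDr mulr1.
  by rewrite big_split /= s c1 addNr.
move/eqP; rewrite psumr_eq0 => [/allP z|i _]; last exact: mulr_ge0.
apply: big1 => i _; have := z i (mem_index_enum i); rewrite /= mulf_eq0.
case/orP => [/eqP ->|]; first by rewrite mul0r.
have [a [b [eab ->]]] := pA i; rewrite !dot_arc => /eqP t.
by rewrite (tc b a) ?subrr ?mulr0 // 1?adjacentC //; lra.
Qed.

(** Together with 0 the facet spans, since a functional vanishing on it comes from
a potential constant along the tight edges. *)
Lemma affine_dim_facet_of phi : facet_potential e phi ->
  affine_dim (facet_of phi) = m%:Z - 1.
Proof.
move=> [lip rig]; have P0 := polytope0 (conj lip rig).
have Fh x : facet_of phi x -> dot x (row_of_potential phi) = -1 by case.
apply/(affine_dim_add_point (y := 0) Fh).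
  by rewrite dot0l; lra.
move=> beta c sp; have c0 : c = 0 by rewrite -(sp 0) ?dot0l //; right.
split=> //; rewrite -[beta]potential_of_rowK; apply: row_of_potential0.
apply: rig => x y exy t; apply/eqP; rewrite -subr_eq0 -potential_of_rowB.
rewrite -opprB dotNl sp ?c0 ?oppr0 //; left; split.
  by apply: polytope_arc; rewrite adjacentC.
by rewrite dot_arc; lra.
Qed.

(** The functional cutting out a proper face is nonzero, even as an affine
functional: the zero functional at height 0 cuts out the whole polytope. *)
Lemma proper_face_affine_dim F : proper_face P F -> affine_dim F <= m%:Z - 1.
Proof.
case=> -[alpha [h [_ ->]]] FP.
apply: (@affine_dim_hyperplane _ _ _ alpha h); first by move=> x [].
case=> a0 h0; apply: FP; apply/seteqP; split=> x /=; first by case.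
by rewrite a0 h0 dot0r.
Qed.

Lemma facet_of_proper phi : facet_potential e phi -> proper_face P (facet_of phi).
Proof.
move=> fp; have P0 := polytope0 fp; case: fp => lip _; split.
  exists (row_of_potential phi), (-1); split=> //; apply: polytope_dot_ge.
    by lra.
  move=> i j eij; rewrite dot_arc.
  by have := lip j i; rewrite adjacentC => /(_ eij); lra.
by move=> FP; move: P0; rewrite -FP => -[_]; rewrite dot0l; lra.
Qed.

(** The facet of [phi0] forces every facet to have dimension [m - 1].  A functional
that is nonnegative on the arcs vanishes on them, because the opposite of an
arc is an arc; hence a proper face is cut out at a negative height [h], which
can be scaled to -1, and rigidity follows from the dimension. *)
Lemma facetsP phi0 F : facet_potential e phi0 ->
  facets P F <-> exists phi, facet_potential e phi /\ F = facet_of phi.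
Proof.
move=> fp0; have P0 := polytope0 fp0; split; last first.
  case=> phi [fp ->]; split; first exact: facet_of_proper.
  by move=> F' /proper_face_affine_dim; rewrite (affine_dim_facet_of fp).
case=> pF maxF.
have dF : affine_dim F = m%:Z - 1.
  apply/eqP; rewrite eq_le proper_face_affine_dim //=.
  by rewrite -(affine_dim_facet_of fp0); apply: maxF; exact: facet_of_proper.
case: pF => -[alpha [h [Ph FE]]] FP.
have h_le0 : h <= 0 by rewrite -(dot0l alpha); exact: Ph.
(* At height 0 the opposite arcs force the functional to vanish on all arcs. *)
have h_lt0 : h < 0.
  rewrite lt_neqAle h_le0 andbT; apply/eqP => h0; subst h.
  apply: FP; rewrite FE; apply/seteqP; split=> x /=; first by case.
  move=> Px; split=> //; apply/le_anti; rewrite Ph // andbT -oppr_ge0 -dotNr.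
  apply: polytope_dot_ge Px => // i j eij.
  by rewrite dotNr -dotNl opprB; apply/Ph/polytope_arc; rewrite adjacentC.
pose phi := potential_of_row ((- h)^-1 *: alpha).
have dphi x : dot x (row_of_potential phi) = (- h)^-1 * dot x alpha.
  by rewrite potential_of_rowK dotZr.
have nh : 0 < - h by rewrite oppr_gt0.
have Fphi : F = facet_of phi.
  rewrite FE; apply/seteqP; split=> x /= [Px xh]; split=> //; move: xh;
    rewrite dphi.
    by move=> ->; rewrite -[X in _ * X]opprK mulrN mulVf ?gt_eqF.
  move=> /(congr1 (fun z => - h * z)).
  by rewrite mulrA divff ?gt_eqF // mul1r; lra.
have lip : lipschitz e phi.
  move=> x y exy; rewrite -dot_arc dphi ler_pdivrMl // mulr1.
  rewrite -[dot _ _]opprK -dotNl opprB lerN2; apply/Ph/polytope_arc.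
  by rewrite adjacentC.
exists phi; split=> //; split=> // psi tc x y; apply/eqP.
rewrite -subr_eq0 -dot_arc.
have Fh z : F z -> dot z alpha = h by rewrite FE => -[].
have h0 : dot 0 alpha <> h by rewrite dot0l => h0; rewrite -h0 ltxx in h_lt0.
have /(affine_dim_add_point Fh h0) sp := dF.
have [|-> _] := sp (row_of_potential psi) 0; last by rewrite dot0r.
move=> z [|/= ->]; last exact: dot0l.
by rewrite Fphi; exact: facet_of_dot0 lip tc z.
Qed.

(** The facet contains the tight arcs of [phi], on which [psi] changes by 1 as
well; rigidity of [phi] makes the difference constant. *)
Lemma facet_of_inj phi psi : facet_potential e phi ->
  facet_of phi = facet_of psi -> forall i j, phi i - phi j = psi i - psi j.
Proof.
move=> [lip rig] E i j.
have /(_ i j) : constant_potential (fun v => phi v - psi v).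
  apply: rig => x y exy t.
  have : facet_of phi (vp y - vp x).
    by split; [apply: polytope_arc; rewrite adjacentC|rewrite dot_arc; lra].
  by rewrite E => -[_]; rewrite dot_arc; lra.
by lra.
Qed.

End Facets.

(** * Cells of the edge contraction subdivision *)

Lemma affinely_spans_convex_hull (R : realType) n (S : set 'rV[R]_n) :
  affinely_spans (convex_hull S) <-> affinely_spans S.
Proof.
split=> sp alpha h Sh; apply: sp => x.
  case=> k [p [c [pS _ c1 ->]]]; rewrite dot_suml -[h]mul1r -c1 mulr_suml.
  by apply: eq_bigr => i _; rewrite Sh.
move=> Sx; apply: Sh; exists 1, (fun=> x), (fun=> 1); split=> //.
  by rewrite big_ord1.
by rewrite big_ord1 scale1r.
Qed.

Section ContractionWeight.
Variables (R : realType) (n : nat).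
Implicit Types (k i j : 'I_n.+1).
Local Notation vp := (vertex_point R).

Lemma contraction_weightC k1 k2 (x : 'rV[R]_n) :
  contraction_weight k1 k2 x = contraction_weight k2 k1 x.
Proof. by rewrite /contraction_weight orbC. Qed.

Lemma contraction_weight_arc k1 k2 i j : i != j ->
  contraction_weight k1 k2 (vp i - vp j)
  = if (i == k1) && (j == k2) || (i == k2) && (j == k1) then 0 else 1.
Proof.
move=> ij; rewrite /contraction_weight; congr (if _ || _ then _ else _).
  by apply/eqP/andP => [/(arc_inj ij)[-> ->]|[/eqP -> /eqP ->]].
by apply/eqP/andP => [/(arc_inj ij)[-> ->]|[/eqP -> /eqP ->]].
Qed.

(** The relation [arcs] stands for the arcs of a cell at height [h] that misses
[e_k2 - e_k1], the arc [e_k1 - e_k2] being exceptional.  Divide [phi - phi k1]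
by [1 - h].  Along a weight-one arc the quotient changes by exactly 1, so that
both ends or neither have an integral value, whereas [k1] has value 0 and, if the exceptional arc is present, [k2] has value
[- h / (1 - h)], which lies strictly between 0 and 1.  Subtracting the indicator
of the vertices with integral value thus lowers the change along the
exceptional arc by 1 and alters no other arc. *)
Lemma negative_height_degenerate k1 k2 (phi : 'I_n.+1 -> R) (h : R)
    (arcs : 'I_n.+1 -> 'I_n.+1 -> Prop) :
  h < 0 ->
  (forall i j, arcs i j -> ((i = k1) /\ (j = k2) /\ phi i - phi j = h) \/
     phi i - phi j = h - 1) ->
  exists psi, forall i j, arcs i j -> psi i - psi j = h - 1.
Proof.
move=> h0 Ch; have h1 : 0 < 1 - h by lra.
pose t v := (phi v - phi k1) / (1 - h).
pose psi v : R := (t v \is a Num.int)%:R.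
exists (fun v => phi v - psi v) => i j /Ch[[-> [-> p]]|p].
  have -> : psi k1 = 1 by rewrite /psi /t subrr mul0r rpred0.
  have -> : psi k2 = 0.
    rewrite /psi; case: intrP => // -[z tz].
    have t0 : 0 < t k2 by apply: divr_gt0 => //; lra.
    have t1 : t k2 < 1 by rewrite ltr_pdivrMr //; lra.
    move: t0 t1; rewrite tz ltr0z -[1]/(1%:~R) ltr_int => z0 z1.
    by move: z1; rewrite ltNge -gtz0_ge1 z0.
  by lra.
have -> : psi i = psi j.
  rewrite /psi; have -> : t j = t i + 1; rewrite /t.
    have -> : phi j = phi i + (1 - h) by lra.
    by rewrite addrAC mulrDl divff ?lt0r_neq0.
  by rewrite rpredDr ?rpred1.
by lra.
Qed.

End ContractionWeight.

Section Cells.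
Variables (R : realType) (n : nat) (G : sgraph 'I_n.+1) (k1 k2 : 'I_n.+1).
Hypothesis k12 : adjacent G k1 k2.
Local Notation A := (@adjacency_config R n G).
Local Notation w := (@contraction_weight R n k1 k2).
Local Notation vp := (vertex_point R).
Local Notation e := (adjacent G).
Implicit Types (phi psi : 'I_n.+1 -> R) (alpha : 'rV[R]_n).

Definition cell_of phi : set 'rV[R]_n :=
  [set x | A x /\ dot x (row_of_potential phi) + (w x)%:~R = 0]%classic.

Let k21 : e k2 k1. Proof. by rewrite adjacentC. Qed.

Let wk12 : w (vp k1 - vp k2) = 0.
Proof. by rewrite (contraction_weight_arc _ _ _ (adjacent_neq k12)) !eqxx. Qed.

Let wk21 : w (vp k2 - vp k1) = 0.
Proof. by rewrite (contraction_weight_arc _ _ _ (adjacent_neq k21)) !eqxx orbT. Qed.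

Lemma arc_config i j : e i j -> A (vp i - vp j).
Proof. by move=> ij; exists i, j. Qed.

Lemma tight_arc_cell phi i j : phi k1 = phi k2 -> e i j -> phi i - phi j = 1 ->
  cell_of phi (vp j - vp i).
Proof.
move=> p12 eij t; split; first by apply: arc_config; rewrite adjacentC.
have ji : e j i by rewrite adjacentC.
rewrite dot_arc (contraction_weight_arc _ _ _ (adjacent_neq ji)).
case: ifP => [/orP[]/andP[/eqP jk /eqP ik]|_]; last by rewrite rmorph1; lra.
  by move: t; rewrite jk ik p12 subrr => /eqP; rewrite eq_sym oner_eq0.
by move: t; rewrite jk ik p12 subrr => /eqP; rewrite eq_sym oner_eq0.
Qed.

(** The weight is defined through points; this reads it off the edges. *)
Lemma config_cases (x : 'rV[R]_n) : A x ->
  [\/ x = vp k1 - vp k2, x = vp k2 - vp k1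
    | exists i j, [/\ e i j, x = vp i - vp j & w x = 1]].
Proof.
case=> i [j [eij ->]]; have ij := adjacent_neq eij.
have := contraction_weight_arc R k1 k2 ij.
case: ifP => [/orP[]/andP[/eqP -> /eqP ->] _|_ wE]; first exact: Or31.
  exact: Or32.
by apply: Or33; exists i, j.
Qed.

Lemma tight_constant_cell phi psi : tight_constant e phi psi ->
  psi k1 = psi k2 ->
  forall x, cell_of phi x -> dot x (row_of_potential psi) = 0.
Proof.
move=> tc p12 x [/config_cases[->|->|[i [j [eij -> ->]]]]]; rewrite !dot_arc.
- by rewrite p12 subrr.
- by rewrite p12 subrr.
- by move=> t; rewrite (tc j i) ?subrr // 1?adjacentC //; lra.
Qed.

(** Both orientations belong to every cell, so 0 is in its affine hull and a
functional constant on the cell has constant value 0. *)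
Lemma cell_of_contracted phi : phi k1 = phi k2 ->
  cell_of phi (vp k1 - vp k2) /\ cell_of phi (vp k2 - vp k1).
Proof.
by move=> p12; split; (split; first exact: arc_config);
  rewrite dot_arc ?wk12 ?wk21 p12 subrr addr0.
Qed.

(** A cell of negative height contains at most one orientation of the contracted
edge, so [negative_height_degenerate] yields a functional with the constant
nonzero value [h - 1] on it. *)
Lemma cell_height_ge0 (C : set 'rV[R]_n) alpha h :
  (C `<=` A)%classic -> affinely_spans C ->
  (forall x, C x -> dot x alpha + (w x)%:~R = h) ->
  0 <= h.
Proof.
move=> CA spC Ch; rewrite leNgt; apply/negP => h0.
pose degenerate := exists psi : 'I_n.+1 -> R, forall i j, e i j ->
  C (vp i - vp j) -> psi i - psi j = h - 1.
suff [psi Cpsi] : degenerate.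
  have [x Cx|_ h1] := spC (row_of_potential psi) (h - 1); last by lra.
  have [i [j [eij xE]]] := CA x Cx.
  by rewrite xE dot_arc; apply: Cpsi => //; rewrite -xE.
have one_arc a b : (forall x, w x = contraction_weight a b x) ->
    ~ C (vp b - vp a) -> degenerate.
  move=> wab Cba; pose phi := potential_of_row alpha.
  have [|psi Hpsi] := @negative_height_degenerate R n a b phi h
    (fun i j => e i j /\ C (vp i - vp j)) h0; last first.
    by exists psi => i j eij Cij; exact: Hpsi.
  move=> i j [eij Cij]; have := Ch _ Cij.
  rewrite wab contraction_weight_arc ?(adjacent_neq eij) //.
  rewrite potential_of_rowB -/phi.
  case: ifP => [/orP[]/andP[/eqP ia /eqP jb] d|_ d].
  - by left; split=> //; split=> //; rewrite -d addr0.
  - by case: Cba; rewrite -ia -jb.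
  - by right; rewrite -d rmorph1 addrK.
have [C12|nC12] := pselect (C (vp k1 - vp k2)); last first.
  by apply: (one_arc k2 k1) => // x; exact: contraction_weightC.
apply: (one_arc k1 k2) => // C21; have := Ch _ C21; have := Ch _ C12.
by rewrite wk12 wk21 -opprB dotNl; lra.
Qed.

Lemma edge_contraction_subdivisionP (C : set 'rV[R]_n) :
  edge_contraction_subdivision G k1 k2 C <->
  exists phi, cell_potential e k1 k2 phi /\ C = cell_of phi.
Proof.
split.
  case=> CA /affine_dim_fullP/affinely_spans_convex_hull spC.
  case=> alpha [h [Ch Ah]].
  have hle x : A x -> h <= dot x alpha + (w x)%:~R.
    move=> Ax; have [/Ch -> //|nC] := pselect (C x).
    by apply/ltW/Ah.
  (* The two orientations of the contracted edge take opposite values, both at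
     least [h]. *)
  have h0 : h = 0.
    apply/le_anti; rewrite (cell_height_ge0 CA spC Ch) andbT.
    have := hle _ (arc_config k12); have := hle _ (arc_config k21).
    by rewrite wk12 wk21 -opprB dotNl; lra.
  subst h; pose phi := potential_of_row alpha.
  have dphi x : dot x (row_of_potential phi) = dot x alpha.
    by rewrite potential_of_rowK.
  have p12 : phi k1 = phi k2.
    have := hle _ (arc_config k12); have := hle _ (arc_config k21).
    by rewrite wk12 wk21 -!dphi !dot_arc; lra.
  have CE : C = cell_of phi.
    apply/seteqP; split=> x.
      by move=> Cx; split; [exact: CA|rewrite dphi; exact: Ch].
    case=> Ax; rewrite dphi => x0; apply: contrapT => nC.
    by have := Ah x (conj Ax nC); rewrite x0 ltxx.
  exists phi; split=> //; split=> //.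
    move=> x y exy; have yx : e y x by rewrite adjacentC.
    have := hle _ (arc_config yx); rewrite -dphi dot_arc.
    rewrite contraction_weight_arc ?(adjacent_neq yx) //.
    by case: ifP => _; rewrite ?rmorph1 ?rmorph0; lra.
  move=> psi psi12 tc x y; apply/eqP; rewrite -subr_eq0 -dot_arc.
  have [|-> _] := spC (row_of_potential psi) 0; last by rewrite dot0r.
  by rewrite CE; exact: tight_constant_cell.
case=> phi [[p12 lip rig] ->]; split; first by move=> x [].
  apply/affine_dim_fullP/affinely_spans_convex_hull => beta c sp.
  have [C12 C21] := cell_of_contracted p12.
  have c0 : c = 0 by have := sp _ C12; have := sp _ C21; rewrite -opprB dotNl; lra.
  split=> //; rewrite -[beta]potential_of_rowK; apply: row_of_potential0.
  apply: rig => [|x y exy t]; apply/eqP; rewrite -subr_eq0 -potential_of_rowB.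
    by rewrite (sp _ C12) c0.
  by rewrite -opprB dotNl (sp _ (tight_arc_cell p12 exy t)) c0 oppr0.
exists (row_of_potential phi), 0; split=> x; first by case.
case=> Ax nC; rewrite lt_neqAle; apply/andP; split.
  by apply/eqP => x0; apply: nC; split.
case: (config_cases Ax) => [->|->|[i [j [eij -> ->]]]].
- by rewrite dot_arc wk12 p12 subrr addr0.
- by rewrite dot_arc wk21 p12 subrr addr0.
- by rewrite dot_arc rmorph1; have := lip j i; rewrite adjacentC => /(_ eij); lra.
Qed.

Lemma cell_of_inj phi psi : cell_potential e k1 k2 phi -> psi k1 = psi k2 ->
  cell_of phi = cell_of psi -> forall i j, phi i - phi j = psi i - psi j.
Proof.
move=> [p12 _ rig] q12 E i j.
have /(_ i j) : constant_potential (fun v => phi v - psi v).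
  apply: rig => [|x y exy t]; first by rewrite p12 q12.
  have C := tight_arc_cell p12 exy t.
  have [_ c1] := C; rewrite E in C; have [_ c2] := C.
  by move: c1 c2; rewrite !dot_arc; lra.
by lra.
Qed.

End Cells.

(** * Distance to the contracted edge *)

Section ExistsCellPotential.
Variables (R : realType) (T : finType) (G : sgraph T) (k1 k2 : T).
Hypothesis GV : vertices G = [set: T]%SET.
Hypothesis Gconn : connected_graph G.
Local Notation e := (adjacent G).

Fixpoint ball (k : nat) : {set T} :=
  if k is k'.+1 then
    (ball k' :|: [set v | [exists u in ball k', e u v]])%SET
  else [set k1; k2]%SET.

Lemma ball_step k u v : u \in ball k -> e u v -> v \in ball k.+1.
Proof.
move=> uk uv; rewrite /= !inE; apply/orP; right.
by apply/existsP; exists u; rewrite uk.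
Qed.

Lemma ball_cover v : exists k, v \in ball k.
Proof.
have [_ /(_ k1 v)] := Gconn; rewrite GV !inE => /(_ isT isT)/connectP[p].
have : exists k, k1 \in ball k by exists 0%N; rewrite !inE eqxx.
elim: p k1 => [|y p IH] x [k xk] /=; first by move=> _ ->; exists k.
by case/andP => xy yp vE; apply: IH yp vE; exists k.+1; exact: ball_step xk xy.
Qed.

Definition dist v : nat := ex_minn (ball_cover v).

Lemma mem_ball_dist v : v \in ball (dist v).
Proof. by rewrite /dist; case: ex_minnP. Qed.

Lemma dist_le k v : v \in ball k -> (dist v <= k)%N.
Proof. by rewrite /dist; case: ex_minnP => d _; exact. Qed.

Lemma dist_step u v : e u v -> (dist v <= (dist u).+1)%N.
Proof. by move=> uv; apply: dist_le; apply: ball_step (mem_ball_dist u) uv. Qed.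

(** The distance to [{k1, k2}]: every other vertex has a neighbour one step
closer, so the tight edges contain a breadth-first forest rooted at [k1] and
[k2]. *)
Lemma exists_cell_potential : exists phi : T -> R, cell_potential e k1 k2 phi.
Proof.
exists (fun v => (dist v)%:R); split.
- have d0 v : v \in ball 0 -> dist v = 0%N.
    by move=> /dist_le; rewrite leqn0 => /eqP.
  by rewrite !d0 // !inE eqxx ?orbT.
- move=> x y xy; rewrite lerBlDr -[1]/(1%:R) -natrD ler_nat add1n.
  by apply: dist_step; rewrite adjacentC.
move=> psi psi12 tc; suff E v : psi v = psi k1 by move=> x y; rewrite !E.
have [d] := ubnPeq (dist v); elim: d v => [|d IH] v /eqP dv.
  by have := mem_ball_dist v; rewrite dv !inE => /orP[]/eqP ->.
have := mem_ball_dist v; rewrite dv /= !inE => /orP[/dist_le|].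
  by rewrite dv ltnn.
case/existsP => u /andP[ud uv]; have du : dist u = d.
  by apply/eqP; rewrite eqn_leq dist_le //= -ltnS -dv dist_step.
rewrite -(IH u) ?du //; apply: tc; first by rewrite adjacentC.
by rewrite dv du -addn1 natrD addrC addKr.
Qed.

End ExistsCellPotential.

(** * Potentials on a contracted part *)

Section EdgeQuotient.
Variables (T : finType) (m : nat) (P : sgraph T) (k1 k2 : T).
Variable H : sgraph 'I_m.+1.
Local Notation merge := (merge_vertex k1 k2).

(** The features of a contraction followed by a relabelling that matter for
potentials, as a property of the composite vertex map. *)
Definition edge_quotient (q : T -> 'I_m.+1) : Prop :=
  [/\ forall j, exists2 v, v \in vertices P & q v = j,
      q k1 = q k2,
      {in vertices P &, forall u v, q u = q v -> merge u = merge v},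
      forall u v, adjacent P u v -> merge u != merge v ->
        adjacent H (q u) (q v)
    & forall i j, adjacent H i j ->
        exists u v, [/\ adjacent P u v, q u = i & q v = j]].

Lemma relabelling_edge_quotient :
  relabelling (contraction P k1 k2) H -> exists q, edge_quotient q.
Proof.
case=> l [l_inj lV _ EH]; exists (l \o merge).
have imset2 (A B : finType) (f : A -> B) x y :
    f @: [set x; y]%SET = [set f x; f y]%SET.
  by rewrite imsetU !imset_set1.
split.
- move=> j; have : j \in l @: vertices (contraction P k1 k2) by rewrite lV inE.
  by case/imsetP => _ /imsetP[v vP ->] ->; exists v.
- by rewrite /= /merge_vertex eqxx; case: eqP.
- by move=> u v uP vP /l_inj; apply; exact: imset_f.
- move=> u v uv muv; rewrite /adjacent EH /= -imset2; apply: imset_f.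
  rewrite inE cards2 muv andbT -imset2; exact: imset_f.
move=> i j ij; have := ij; rewrite {1}/adjacent EH => /imsetP[d].
rewrite inE => /andP[/imsetP[e eP ->] _].
have /andP[_ /cards2P[x [y [_ eE]]]] := edgesP eP.
rewrite eE !imset2 => E.
have : i \in [set i; j]%SET by rewrite !inE eqxx.
have : j \in [set i; j]%SET by rewrite !inE eqxx orbT.
have xy : adjacent P x y by rewrite /adjacent -eE.
have yx : adjacent P y x by rewrite adjacentC.
rewrite E !inE => /orP[]/eqP jE /orP[]/eqP iE.
- by have := adjacent_neq ij; rewrite iE jE eqxx.
- by exists y, x.
- by exists x, y.
- by have := adjacent_neq ij; rewrite iE jE eqxx.
Qed.

End EdgeQuotient.

Section Part.
Variables (R : realType) (T : finType) (m : nat) (G P : sgraph T) (k1 k2 : T).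
Variables (H : sgraph 'I_m.+1) (q : T -> 'I_m.+1).
Hypothesis k1P : k1 \in vertices P.
Hypothesis k2P : k2 \in vertices P.
Hypothesis PG : forall x y, adjacent P x y -> adjacent G x y.
Hypothesis outP : forall x y, adjacent G x y ->
  adjacent P x y \/
  forall z, z = x \/ z = y -> z \in vertices P -> z = k1 \/ z = k2.
Hypothesis qP : edge_quotient P k1 k2 H q.
Implicit Types (phi psi : T -> R).
Local Notation merge := (merge_vertex k1 k2).

(** The potential induced on the quotient, meaningful when [phi k1 = phi k2].  An
edge quotient is onto, so there the default value 0 is never taken. *)
Definition descend phi (j : 'I_m.+1) : R :=
  if [pick v in vertices P | q v == j] is Some v then phi v else 0.

Lemma merge_potential phi v : phi k1 = phi k2 -> phi (merge v) = phi v.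
Proof. by rewrite /merge_vertex; case: eqP => [->|]. Qed.

Lemma descendE phi v : phi k1 = phi k2 -> v \in vertices P ->
  descend phi (q v) = phi v.
Proof.
move=> p12 vP; rewrite /descend; case: pickP => [u /andP[uP /eqP quv]|].
  have [_ _ inj _ _] := qP.
  by rewrite -(merge_potential u p12) (inj u v) // merge_potential.
by move=> /(_ v); rewrite vP eqxx.
Qed.

Lemma descend_diff phi psi : phi k1 = phi k2 -> psi k1 = psi k2 ->
  (forall u v, phi u - phi v = psi u - psi v) ->
  forall i j, descend phi i - descend phi j = descend psi i - descend psi j.
Proof.
move=> p12 s12 D i j; have [surj _ _ _ _] := qP.
have [x xP <-] := surj i; have [y yP <-] := surj j.
by rewrite !descendE.
Qed.

Lemma adjacent_mem x y : adjacent P x y -> x \in vertices P /\ y \in vertices P.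
Proof.
by move=> /edgesP/andP[/fintype.subsetP s _]; split; apply: s; rewrite !inE eqxx ?orbT.
Qed.

Lemma descend_lipschitz phi : phi k1 = phi k2 -> lipschitz (adjacent H) (descend phi) ->
  forall x y, adjacent P x y -> phi x - phi y <= 1.
Proof.
move=> p12 lip x y xy; have [xP yP] := adjacent_mem xy.
have [_ _ _ edge _] := qP.
have [mxy|/(edge _ _ xy)/lip] := eqVneq (merge x) (merge y).
  by rewrite -(merge_potential x p12) mxy merge_potential // subrr.
by rewrite !descendE.
Qed.

Lemma descend_rigid phi psi : phi k1 = phi k2 -> psi k1 = psi k2 ->
  facet_potential (adjacent H) (descend phi) ->
  tight_constant (adjacent G) phi psi ->
  forall v, v \in vertices P -> psi v = psi k1.
Proof.
move=> p12 s12 [_ rig] tc v vP; have [_ _ _ _ edge] := qP.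
rewrite -(descendE s12 vP) -(descendE s12 k1P); apply: rig => i j /edge[x [y [xy <- <-]]].
by have [xP yP] := adjacent_mem xy; rewrite !descendE //; exact/tc/PG.
Qed.

(** A potential on [H] constant along tight edges is extended to [G] by its value
at the contracted vertex; the extension is constant along the tight edges of
the other part, which meets [P] only in [k1] and [k2].  So rigidity on [G]
gives rigidity on [H]. *)
Lemma descend_facet_potential phi : cell_potential (adjacent G) k1 k2 phi ->
  facet_potential (adjacent H) (descend phi).
Proof.
case=> p12 lip rig; have [surj q12 _ edge edgeV] := qP; split.
  move=> i j /edgeV[x [y [xy <- <-]]]; have [xP yP] := adjacent_mem xy.
  by rewrite !descendE //; exact/lip/PG.
move=> psi tc; pose psi' v := if v \in vertices P then psi (q v) else psi (q k1).
have psi'k : psi' k1 = psi' k2 by rewrite /psi' k1P k2P q12.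
have E : constant_potential psi'.
  apply: rig => // x y xy t; case: (outP xy) => [Pxy|out].
    have [xP yP] := adjacent_mem Pxy; rewrite /psi' xP yP.
    have [mxy|ne] := eqVneq (merge x) (merge y).
      move: t; rewrite -(merge_potential x p12) mxy merge_potential // subrr.
      by move=> /eqP; rewrite eq_sym oner_eq0.
    by apply: tc (edge _ _ Pxy ne) _; rewrite !descendE.
  have k z : z = x \/ z = y -> psi' z = psi (q k1).
    rewrite {1}/psi' => /out; case: ifP => // _ /(_ isT)[-> //|->].
    by rewrite q12.
  by rewrite !k; [|right|left].
move=> i j; have [x xP <-] := surj i; have [y yP <-] := surj j.
by have := E x y; rewrite /psi' xP yP.
Qed.

End Part.

Lemma facet_potential_shift (R : realType) (T : finType) (e : rel T)
    (phi psi : T -> R) :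
  (forall x y, phi x - phi y = psi x - psi y) ->
  facet_potential e phi -> facet_potential e psi.
Proof.
move=> E [lip rig]; split=> [x y xy|chi tc]; first by rewrite -E; exact: lip.
by apply: rig => x y xy t; apply: tc => //; rewrite -E.
Qed.

(** * Gluing two parts along an edge *)

Section Gluing.
Variables (R : realType) (T : finType) (G G1 G2 : sgraph T) (k1 k2 : T).
Variables (m1 m2 : nat) (H1 : sgraph 'I_m1.+1) (H2 : sgraph 'I_m2.+1).
Variables (q1 : T -> 'I_m1.+1) (q2 : T -> 'I_m2.+1).
Hypothesis GV : forall v, (v \in vertices G1) || (v \in vertices G2).
Hypothesis E12 : forall x y, adjacent G x y = adjacent G1 x y || adjacent G2 x y.
Hypothesis V12I : (vertices G1 :&: vertices G2)%SET = [set k1; k2]%SET.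
Hypothesis q1P : edge_quotient G1 k1 k2 H1 q1.
Hypothesis q2P : edge_quotient G2 k1 k2 H2 q2.
Implicit Types (phi : T -> R).

Let kV v : v = k1 \/ v = k2 -> v \in vertices G1 /\ v \in vertices G2.
Proof.
move=> vk; apply/andP; rewrite -finset.in_setI V12I !inE.
by case: vk => ->; rewrite eqxx ?orbT.
Qed.

Let Vk v : v \in vertices G1 -> v \in vertices G2 -> v = k1 \/ v = k2.
Proof.
move=> v1 v2; have : v \in [set k1; k2]%SET by rewrite -V12I inE v1.
by rewrite !inE => /orP[]/eqP; [left|right].
Qed.

Lemma glue_cell_potential phi : phi k1 = phi k2 ->
  facet_potential (adjacent H1) (descend G1 q1 phi) ->
  facet_potential (adjacent H2) (descend G2 q2 phi) ->
  cell_potential (adjacent G) k1 k2 phi.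
Proof.
move=> p12 f1 f2; have [k11 k12] := kV (or_introl erefl).
split=> // [x y|psi s12 tc].
  rewrite E12 => /orP[]; first exact: (descend_lipschitz q1P p12 (proj1 f1)).
  exact: (descend_lipschitz q2P p12 (proj1 f2)).
suff E v : psi v = psi k1 by move=> x y; rewrite !E.
have /orP[] := GV v.
  by apply: (descend_rigid k11 _ q1P p12 s12 f1 tc) => x y xy; rewrite E12 xy.
by apply: (descend_rigid k12 _ q2P p12 s12 f2 tc) => x y xy; rewrite E12 xy orbT.
Qed.

Lemma split_cell_potential phi : cell_potential (adjacent G) k1 k2 phi ->
  facet_potential (adjacent H1) (descend G1 q1 phi) /\
  facet_potential (adjacent H2) (descend G2 q2 phi).
Proof.
move=> cp; have [k11 k12] := kV (or_introl erefl).
have [k21 k22] := kV (or_intror erefl).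
split; [apply: (descend_facet_potential k11 k21 _ _ q1P cp)
       |apply: (descend_facet_potential k12 k22 _ _ q2P cp)];
  move=> x y; rewrite E12.
- by move=> ->.
- case/orP => [|/adjacent_mem[x2 y2]]; [by left|right].
  by move=> z [] -> z1; exact: Vk.
- by move=> ->; rewrite orbT.
- case/orP => [/adjacent_mem[x1 y1]|]; [right|by left].
  by move=> z [] -> z2; exact: Vk.
Qed.

(** Normalising both potentials to vanish at the contracted vertex makes them
agree on the intersection [{k1, k2}] of the two parts. *)
Lemma exists_glued_potential (phi1 : 'I_m1.+1 -> R) (phi2 : 'I_m2.+1 -> R) :
  exists phi, [/\ phi k1 = phi k2,
    forall i j, descend G1 q1 phi i - descend G1 q1 phi j = phi1 i - phi1 j
  & forall i j, descend G2 q2 phi i - descend G2 q2 phi j = phi2 i - phi2 j].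
Proof.
have [k11 k12] := kV (or_introl erefl); have [k21 k22] := kV (or_intror erefl).
have [s1 q112 _ _ _] := q1P; have [s2 q212 _ _ _] := q2P.
pose phi v := if v \in vertices G1 then phi1 (q1 v) - phi1 (q1 k1)
              else phi2 (q2 v) - phi2 (q2 k1).
have p12 : phi k1 = phi k2 by rewrite /phi k11 k21 q112.
exists phi; split=> // i j.
  have [x xV <-] := s1 i; have [y yV <-] := s1 j.
  by rewrite !(descendE q1P) // /phi xV yV; ring.
have phiE v : v \in vertices G2 -> phi v = phi2 (q2 v) - phi2 (q2 k1).
  rewrite /phi => v2; case: ifP => // v1.
  by case: (Vk v1 v2) => ->; rewrite -?q112 -?q212 !subrr.
have [x xV <-] := s2 i; have [y yV <-] := s2 j.
by rewrite !(descendE q2P) // !phiE //; ring.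
Qed.

Lemma potential_determined_by_parts phi psi : phi k1 = phi k2 ->
  psi k1 = psi k2 ->
  (forall i j, descend G1 q1 phi i - descend G1 q1 phi j
             = descend G1 q1 psi i - descend G1 q1 psi j) ->
  (forall i j, descend G2 q2 phi i - descend G2 q2 phi j
             = descend G2 q2 psi i - descend G2 q2 psi j) ->
  forall u v, phi u - phi v = psi u - psi v.
Proof.
move=> p12 s12 D1 D2; have [k11 k12] := kV (or_introl erefl).
suff E v : phi v - phi k1 = psi v - psi k1.
  by move=> u v; have := E u; have := E v; lra.
have /orP[vV|vV] := GV v.
  by have := D1 (q1 v) (q1 k1); rewrite !(descendE q1P).
by have := D2 (q2 v) (q2 k1); rewrite !(descendE q2P).
Qed.

End Gluing.

Theorem theorem1 (R : realType) (n : nat) (G G1 G2 : sgraph 'I_n.+1)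
    (k1 k2 : 'I_n.+1) (m1 m2 : nat)
    (G1' : sgraph 'I_m1.+1) (G2' : sgraph 'I_m2.+1)
    (GV : vertices G = [set: 'I_n.+1]%SET)
    (Gconn : connected_graph G)
    (V12 : vertices G = (vertices G1 :|: vertices G2)%SET)
    (E12 : edges G = (edges G1 :|: edges G2)%SET)
    (V12I : (vertices G1 :&: vertices G2)%SET = [set k1; k2]%SET)
    (E12I : (edges G1 :&: edges G2)%SET = [set [set k1; k2]]%SET)
    (G1'E : relabelling (contraction G1 k1 k2) G1')
    (G2'E : relabelling (contraction G2 k1 k2) G2') :
  exists f : set 'rV[R]_n -> set 'rV[R]_m1 * set 'rV[R]_m2,
    set_bij (edge_contraction_subdivision G k1 k2)
      (facets (adjacency_polytope G1') `*` facets (adjacency_polytope G2'))%classic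
      f.
Proof.
have [q1 q1P] := relabelling_edge_quotient G1'E.
have [q2 q2P] := relabelling_edge_quotient G2'E.
have Vcover v : (v \in vertices G1) || (v \in vertices G2).
  by rewrite -finset.in_setU -V12 GV inE.
have Ecover x y : adjacent G x y = adjacent G1 x y || adjacent G2 x y.
  by rewrite /adjacent E12 inE.
have k12 : adjacent G k1 k2.
  have : [set k1; k2]%SET \in (edges G1 :&: edges G2)%SET by rewrite E12I inE.
  by rewrite inE Ecover => /andP[kE _]; apply/orP; left.
have [phi0 cp0] := exists_cell_potential R k1 k2 GV Gconn.
have splitP := split_cell_potential Ecover V12I q1P q2P.
have [fp1 fp2] := splitP R phi0 cp0.
have /choice[f fP] : forall C, exists F : set 'rV[R]_m1 * set 'rV[R]_m2,
    edge_contraction_subdivision G k1 k2 C ->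
    exists phi, [/\ cell_potential (adjacent G) k1 k2 phi, C = cell_of G k1 k2 phi
      & F = (facet_of G1' (descend G1 q1 phi), facet_of G2' (descend G2 q2 phi))].
  move=> C; have [/(edge_contraction_subdivisionP k12)[phi [cp CE]]|nC] :=
    pselect (edge_contraction_subdivision G k1 k2 C); last by exists (set0, set0).
  by eexists=> _; exists phi; split.
exists f; split.
- move=> C /fP[phi [cp _ ->]]; have [f1 f2] := splitP R phi cp.
  by split; [apply/(facetsP _ fp1)|apply/(facetsP _ fp2)]; eexists; split;
    [|reflexivity| |reflexivity].
- move=> C D /set_mem/fP[phi [cp -> ->]] /set_mem/fP[psi [cs -> ->]] [F1 F2].
  have [f1 f2] := splitP R phi cp.
  have [p12 _ _] := cp; have [s12 _ _] := cs.
  have D12 := potential_determined_by_parts Vcover V12I q1P q2P p12 s12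
    (facet_of_inj f1 F1) (facet_of_inj f2 F2).
  by rewrite /cell_of (row_of_potential_eq D12).
move=> [F1 F2] [/= /(facetsP _ fp1)[phi1 [f1 ->]] /(facetsP _ fp2)[phi2 [f2 ->]]].
have [phi [p12 D1 D2]] := exists_glued_potential V12I q1P q2P phi1 phi2.
have cp : cell_potential (adjacent G) k1 k2 phi.
  apply: (glue_cell_potential Vcover Ecover V12I q1P q2P p12).
    by apply: facet_potential_shift f1 => x y; rewrite D1.
  by apply: facet_potential_shift f2 => x y; rewrite D2.
have Ccell : edge_contraction_subdivision G k1 k2 (cell_of G k1 k2 phi).
  by apply/(edge_contraction_subdivisionP k12); exists phi.
exists (cell_of G k1 k2 phi) => //.
have [psi [[s12 _ _] CE ->]] := fP _ Ccell.
have D := cell_of_inj cp s12 CE.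
rewrite /facet_of; congr (_, _).
  have <- // : row_of_potential (descend G1 q1 phi) = row_of_potential phi1.
    exact: row_of_potential_eq.
  by rewrite (row_of_potential_eq (descend_diff q1P p12 s12 D)).
have <- // : row_of_potential (descend G2 q2 phi) = row_of_potential phi2.
  exact: row_of_potential_eq.
by rewrite (row_of_potential_eq (descend_diff q2P p12 s12 D)).
Qed.
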